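(* Let $a<b$, $\sigma>0$, $\beta>0$, let $V:[a,b]\to\mathbb{R}$ be a real-valued potential, let $g:[0,\infty)\to\mathbb{R}$ be a monotonically increasing function with $g(s)\ge 0$ for all $s\ge 0$, and let $\psi_0:[a,b]\to\mathbb{C}$ satisfy $\psi_0(a)=\psi_0(b)=0$. Let $(\psi^n)_{n\ge 0}$, $\psi^n=(\psi^n_0,\dots,\psi^n_M)\in\mathbb{C}^{M+1}$, be the sequence generated by the time-splitting sine-spectral (TSSP) scheme (defined in the context) for the damped nonlinear Schrödinger equation $$i\,\psi_t=-\tfrac12\psi_{xx}+V(x)\psi-\beta|\psi|^{2\sigma}\psi-i\,g(|\psi|^2)\psi,\qquad a<x<b,\ t>0,$$ with $\psi(x,0)=\psi_0(x)$ and $\psi(a,t)=\psi(b,t)=0$. Then the TSSP scheme is unconditionally stable; in fact, for every mesh size $\Delta x=(b-a)/M>0$ ($M$ an even positive integer) and every time step $k>0$, $$\|\psi^{n+1}\|_{l^2}\le\|\psi^n\|_{l^2}\le\|\psi^0\|_{l^2}=\|\psi_0\|_{l^2},\qquad n=0,1,2,\dots$$ Furthermore, if the damping is linear, i.e. $g(\rho)\equiv\delta$ for a constant $\delta>0$, then, with $t_n=nk$, $$\|\psi^n\|_{l^2}^2=e^{-2\delta t_n}\|\psi^0\|_{l^2}^2=e^{-2\delta t_n}\|\psi_0\|_{l^2}^2,\qquad n=1,2,\dots$$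
   Context: **Grid and norm.** $M$ is an even positive integer, $\Delta x=(b-a)/M$, $x_j=a+j\,\Delta x$ for $j=0,\dots,M$; $k>0$ is the time step and $t_n=nk$. For $U=(U_0,\dots,U_M)\in\mathbb{C}^{M+1}$ with $U_0=U_M=0$, $$\|U\|_{l^2}=\sqrt{\frac{b-a}{M}\sum_{j=1}^{M-1}|U_j|^2},$$ and $\|\psi_0\|_{l^2}$ denotes this norm of the vector of samples $(\psi_0(x_0),\dots,\psi_0(x_M))$. **Sine transform.** For $l=1,\dots,M-1$, $\mu_l=\frac{\pi l}{b-a}$ and $\widehat{U}_l=\frac{2}{M}\sum_{j=1}^{M-1}U_j\sin(\mu_l(x_j-a))$. **Auxiliary functions.** For $s\ge0$, $\tau\ge 0$, $h(s,\tau)\ge 0$ is the solution at time $\tau$ of the damping ODE $$\partial_\tau h(s,\tau)=-2\,g(h(s,\tau))\,h(s,\tau),\qquad h(s,0)=s$$ (so $h(0,\tau)=0$, and where $g>0$ one has $h(s,\tau)=f^{-1}(f(s)-2\tau)$ for $s>0$, with $f(s)=\int\frac{ds}{s\,g(s)}$ an antiderivative). It is a standing assumption that this $h$ is well defined for the given $g$. For $s,r\ge 0$ set $$F(s,r)=\int_0^r g(h(s,\tau))\,d\tau,\qquad G(s,r)=\int_0^r\beta\,[h(s,\tau)]^{\sigma}\,d\tau.$$ (For $g\equiv\delta$: $h(s,\tau)=e^{-2\delta\tau}s$, $F(s,r)=\delta r$, $G(s,r)=\frac{\beta s^\sigma}{2\delta\sigma}(1-e^{-2\delta\sigma r})$.)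 **TSSP scheme.** $\psi^0_j=\psi_0(x_j)$ for $j=0,\dots,M$. Given $\psi^n$ (with $\psi^n_0=\psi^n_M=0$), $\psi^{n+1}$ is defined by $\psi^{n+1}_0=\psi^{n+1}_M=0$ and, for $j=1,\dots,M-1$, $$\psi^*_j=\exp\Big\{-F(|\psi^n_j|^2,k/2)+i\big[-V(x_j)k/2+G(|\psi^n_j|^2,k/2)\big]\Big\}\,\psi^n_j,$$ $$\psi^{**}_j=\sum_{l=1}^{M-1}e^{-ik\mu_l^2/2}\,\widehat{\psi^*}_l\,\sin(\mu_l(x_j-a)),$$ $$\psi^{n+1}_j=\exp\Big\{-F(|\psi^{**}_j|^2,k/2)+i\big[-V(x_j)k/2+G(|\psi^{**}_j|^2,k/2)\big]\Big\}\,\psi^{**}_j.$$ *)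

(* Defs.v *)
From mathcomp Require Import all_boot all_order all_algebra.
From mathcomp Require Import all_classical all_reals all_analysis.
From mathcomp Require Import complex.

Set Implicit Arguments.
Unset Strict Implicit.
Unset Printing Implicit Defensive.

Import Order.TTheory GRing.Theory Num.Theory.
Import numFieldNormedType.Exports.
Import Normc.

Local Open Scope classical_set_scope.
Local Open Scope ring_scope.
Local Open Scope complex_scope.

Definition cexp (R : realType) (z : R[i]) : R[i] :=
  (expR (complex.Re z))%:C * (cos (complex.Im z) +i* sin (complex.Im z)).

(* Only the restriction of h to [0, +oo[ x [0, +oo[ is constrained or used;
   the equation is required classically: h s is continuous up to tau = 0 and
   differentiable at every tau > 0. *)
Definition is_damping_flow (R : realType) (g : R -> R) (h : R -> R -> R) :
    Prop :=
  forall s : R, 0 <= s ->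
    [/\ h s 0 = s,
        forall tau : R, 0 <= tau -> 0 <= h s tau,
        {within `[0, +oo[, continuous (h s)} &
        forall tau : R, 0 < tau ->
          is_derive tau 1 (h s) (- 2 * g (h s tau) * h s tau)].

Definition damping_F (R : realType) (g : R -> R) (h : R -> R -> R)
    (s r : R) : R :=
  \int[lebesgue_measure]_(tau in `[0, r]) g (h s tau).

Definition phase_G (R : realType) (sigma beta : R) (h : R -> R -> R)
    (s r : R) : R :=
  \int[lebesgue_measure]_(tau in `[0, r]) (beta * h s tau `^ sigma).

Definition grid_pt (R : realType) (a b : R) (M j : nat) : R :=
  a + j%:R * ((b - a) / M%:R).

Definition sample (R : realType) (a b : R) (M : nat) (f : R -> R[i]) :
    'I_M.+1 -> R[i] :=
  fun j => f (grid_pt a b M j).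

Definition l2norm (R : realType) (a b : R) (M : nat) (U : 'I_M.+1 -> R[i]) :
    R :=
  Num.sqrt ((b - a) / M%:R * \sum_(j < M.+1 | (0 < j < M)%N) normc (U j) ^+ 2).

Definition mu (R : realType) (a b : R) (l : nat) : R := pi * l%:R / (b - a).

Definition sine_coef (R : realType) (a b : R) (M : nat)
    (U : 'I_M.+1 -> R[i]) (l : nat) : R[i] :=
  (2 / M%:R)%:C *
  \sum_(j < M.+1 | (0 < j < M)%N)
     U j * (sin (mu a b l * (grid_pt a b M j - a)))%:C.

Definition local_substep (R : realType) (a b sigma beta : R) (V g : R -> R)
    (h : R -> R -> R) (k : R) (M : nat) (U : 'I_M.+1 -> R[i]) :
    'I_M.+1 -> R[i] :=
  fun j =>
    cexp ((- damping_F g h (normc (U j) ^+ 2) (k / 2)) +i*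
          (- V (grid_pt a b M j) * k / 2
           + phase_G sigma beta h (normc (U j) ^+ 2) (k / 2))) * U j.

Definition kinetic_substep (R : realType) (a b k : R) (M : nat)
    (U : 'I_M.+1 -> R[i]) : 'I_M.+1 -> R[i] :=
  fun j => \sum_(1 <= l < M)
    cexp (0 +i* (- (k * mu a b l ^+ 2 / 2))) * sine_coef a b U l *
    (sin (mu a b l * (grid_pt a b M j - a)))%:C.

Definition tssp_step (R : realType) (a b sigma beta : R) (V g : R -> R)
    (h : R -> R -> R) (k : R) (M : nat) (U : 'I_M.+1 -> R[i]) :
    'I_M.+1 -> R[i] :=
  fun j =>
    if (0 < j < M)%N then
      local_substep a b sigma beta V g h k
        (kinetic_substep a b k (local_substep a b sigma beta V g h k U)) j
    else 0.

Definition tssp (R : realType) (a b sigma beta : R) (V g : R -> R)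
    (h : R -> R -> R) (psi0 : R -> R[i]) (k : R) (M n : nat) :
    'I_M.+1 -> R[i] :=
  iter n (tssp_step a b sigma beta V g h k (M := M)) (sample a b psi0).

(* Main.v *)
Require Import Defs.
From mathcomp Require Import all_boot all_order all_algebra.
From mathcomp Require Import all_classical all_reals all_analysis.
From mathcomp Require Import complex.
From mathcomp Require Import ring.

(** Each step composes three maps: a local substep, the kinetic substep and a
    local substep again.

    A local substep multiplies the value at each node by a complex exponential
    of modulus [exp (- F)].  Since the damping flow keeps [h >= 0], the
    integrand [g (h s tau)] of [F] is nonnegative, so the modulus is at most
    [1] and the discrete norm cannot grow ([l2norm_local_le]).  When [g] is the
    constant [delta], [F = delta * k / 2] whatever the value at the node, so the
    squared norm is multiplied by exactly [exp (- delta * k)]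
    ([l2norm_local_linear]); the two local substeps of a step together give
    [exp (- 2 * delta * k)].

    The kinetic substep preserves the norm ([l2norm_kinetic]).  The vectors
    [sin (pi l j / M)], for [l] between [1] and [M - 1], are orthogonal with
    common squared norm [M / 2] ([dsin_orthogonal]), which gives a Parseval
    identity for the sine transform and its inverse ([sum_normc_dsin]); between
    the two, every coefficient is multiplied by a number of modulus [1].

    The theorem follows by induction on the number of steps. *)

Set Implicit Arguments.
Unset Strict Implicit.
Unset Printing Implicit Defensive.

Import Order.TTheory GRing.Theory Num.Theory.
Import numFieldNormedType.Exports.
Import Normc.

Local Open Scope classical_set_scope.
Local Open Scope ring_scope.
Local Open Scope complex_scope.

(** * Orthogonality of the discrete sines *)

Definition dsin (R : realType) (M l j : nat) : R :=
  sin (j%:R * (pi * l%:R / M%:R)).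

(** The symmetry that makes the sine transform its own inverse up to a factor,
    so that one orthogonality relation serves both directions. *)
Lemma dsinC (R : realType) (M l j : nat) : dsin R M l j = dsin R M j l.
Proof. by rewrite /dsin; congr (sin _); ring. Qed.

Lemma sin_cos_natpi (R : realType) (m : nat) :
  sin (pi * m%:R) = 0 :> R /\ cos (pi * m%:R) = (-1) ^+ m :> R.
Proof.
elim: m => [|m [IHs IHc]]; first by rewrite mulr0 sin0 cos0.
by rewrite -natr1 mulrDr mulr1 sinDpi cosDpi IHs IHc oppr0 exprS mulN1r.
Qed.

(** Multiplying by [sin (x / 2)], which is nonzero at [x = pi m / M] for
    [0 < m < 2 M], turns the left-hand side into a telescoping sum.  Only the
    parity of [m] survives, so two such sums with frequencies of the same parity
    cancel. *)
Lemma sum_cos_natpi (R : realType) (M m : nat) : (0 < m < M.*2)%N ->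
  2 * \sum_(1 <= j < M) cos (j%:R * (pi * m%:R / M%:R)) =
  - ((-1) ^+ m + 1) :> R.
Proof.
case/andP=> m_gt0 m_lt; have M_gt0 : (0 < M)%N by case: (M) m_lt.
have MR0 : (0 : R) < M%:R by rewrite ltr0n.
set x : R := pi * m%:R / M%:R.
have mR0 : (0 : R) < m%:R by rewrite ltr0n.
have mltR : m%:R < 2 * M%:R :> R by rewrite -natrM mul2n ltr_nat.
have pi0 := pi_gt0 R.
have sx : 0 < sin (x / 2).
  apply: sin_gt0_pi; apply/andP; split; first by rewrite !divr_gt0 ?mulr_gt0.
  by rewrite /x -!mulrA gtr_pMr // -invfM ltr_pdivrMr ?mul1r 1?mulrC ?mulr_gt0.
apply: (mulfI (lt0r_neq0 sx)).
rewrite !mulr_sumr (telescope_sumr_eq (fun j => sin ((j%:R - 1 / 2) * x))) //.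
  have -> : (M%:R - 1 / 2) * x = pi * m%:R - x / 2.
    by rewrite /x; field; rewrite lt0r_neq0.
  have [spi cpi] := sin_cos_natpi R m.
  rewrite sinB spi cpi.
  have -> : (1 - 1 / 2) * x = x / 2 by field.
  by ring.
move=> j _ /=; rewrite -[j.+1%:R]natr1.
have -> : (j%:R + 1 - 1 / 2) * x = j%:R * x + x / 2 by field.
have -> : (j%:R - 1 / 2) * x = j%:R * x - x / 2 by field.
by rewrite sinD sinB; ring.
Qed.

Lemma dsin_mul (R : realType) (M l m j : nat) : (m <= l)%N ->
  2 * (dsin R M l j * dsin R M m j) =
  cos (j%:R * (pi * (l - m)%:R / M%:R)) - cos (j%:R * (pi * (l + m)%:R / M%:R)).
Proof.
move=> le_ml; rewrite /dsin natrB // natrD.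
rewrite (_ : _ * (_ * (_ - _) / _) =
  j%:R * (pi * l%:R / M%:R) - j%:R * (pi * m%:R / M%:R)); last by ring.
rewrite (_ : _ * (_ * (_ + _) / _) =
  j%:R * (pi * l%:R / M%:R) + j%:R * (pi * m%:R / M%:R)); last by ring.
by rewrite cosB cosD; ring.
Qed.

(** A product of two sines is half the difference of the cosines with
    frequencies [l - m] and [l + m].  These have the same parity, so their sums
    cancel unless [l = m], where the first cosine is constantly [1]. *)
Lemma dsin_orthogonal (R : realType) (M l m : nat) :
  (0 < l < M)%N -> (0 < m < M)%N ->
  \sum_(1 <= j < M) dsin R M l j * dsin R M m j =
  if l == m then M%:R / 2 else 0.
Proof.
wlog le_ml : l m / (m <= l)%N => [hwlog hl hm|].
  have [le_ml|/ltnW le_lm] := leqP m l; first exact: hwlog.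
  by rewrite eq_sym -hwlog //; apply: eq_bigr => j _; rewrite mulrC.
move=> /andP[l_gt0 l_lt] /andP[m_gt0 m_lt].
have two0 : 2 != 0 :> R by [].
apply: (mulfI two0); rewrite mulr_sumr.
under eq_bigr => j _ do rewrite dsin_mul //.
apply: (mulfI two0); rewrite sumrB mulrBr.
rewrite (@sum_cos_natpi R M (l + m)); last first.
  by rewrite addn_gt0 l_gt0 -addnn -addSn leq_add // ltnW.
case: eqVneq => [->|neq_lm].
  under eq_bigr => j _ do rewrite subnn mulr0 mul0r mulr0 cos0.
  rewrite sumr_const_nat natrB ?(ltn_trans m_gt0) // addnn.
  rewrite -mul2n exprM sqrrN !expr1n.
  by field.
have lt_ml : (m < l)%N by rewrite ltn_neqAle eq_sym neq_lm.
rewrite sum_cos_natpi; last first.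
  by rewrite subn_gt0 lt_ml -addnn (leq_ltn_trans (leq_subr _ _)) // ltn_addr.
(* The parities of [l + m] and [l - m] agree. *)
have -> : (l + m = (l - m) + m.*2)%N by rewrite -addnn addnA subnK.
by rewrite exprD -mul2n exprM sqrrN !expr1n; ring.
Qed.

(** * Parseval identity for the sine transform *)

Lemma sum_interior_ord (V : nmodType) (M : nat) (F : nat -> V) :
  \sum_(1 <= j < M) F j = \sum_(j < M.+1 | (0 < j < M)%N) F j.
Proof.
rewrite (big_nat_widen _ _ M.+1) // (big_nat_widenl _ 0) // big_mkord.
by apply: eq_bigl => j; rewrite andbC.
Qed.

Lemma sqr_normc (R : rcfType) (z : R[i]) :
  normc z ^+ 2 = complex.Re z ^+ 2 + complex.Im z ^+ 2.
Proof. by case: z => x y /=; rewrite sqr_sqrtr // addr_ge0 ?sqr_ge0. Qed.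

Lemma sum_sqr_orthogonal (R : comNzRingType) (I : finType) (P : pred I) (c : R)
    (S : I -> I -> R) (u : I -> R) :
  (forall l m, P l -> P m ->
     \sum_(j | P j) S l j * S m j = if l == m then c else 0) ->
  \sum_(j | P j) (\sum_(l | P l) u l * S l j) ^+ 2 =
  c * \sum_(l | P l) u l ^+ 2.
Proof.
move=> orthS; rewrite mulr_sumr.
under eq_bigr => j _ do rewrite expr2 big_distrlr /=.
rewrite exchange_big /=; apply: eq_bigr => l Pl.
rewrite exchange_big /= (bigD1 l) //= [X in _ + X]big1 ?addr0;
  last move=> m /andP[Pm neq_ml].
  under eq_bigr => j _ do rewrite mulrACA.
  by rewrite -mulr_sumr orthS // eqxx mulrC expr2.
under eq_bigr => j _ do rewrite mulrACA.
by rewrite -mulr_sumr orthS // eq_sym (negPf neq_ml) mulr0.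
Qed.

(** The kernel is real, so the real and imaginary parts of the coefficients
    do not mix and the real identity applies to each. *)
Lemma sum_normc_orthogonal (R : rcfType) (I : finType) (P : pred I) (c : R)
    (S : I -> I -> R) (u : I -> R[i]) :
  (forall l m, P l -> P m ->
     \sum_(j | P j) S l j * S m j = if l == m then c else 0) ->
  \sum_(j | P j) normc (\sum_(l | P l) u l * (S l j)%:C) ^+ 2 =
  c * \sum_(l | P l) normc (u l) ^+ 2.
Proof.
move=> orthS.
under eq_bigr => j _ do rewrite sqr_normc !raddf_sum /=.
under [in RHS]eq_bigr => l _ do rewrite sqr_normc.
rewrite !big_split /= mulrDr -!(sum_sqr_orthogonal _ orthS).
congr (_ + _); apply: eq_bigr => j _; congr (_ ^+ 2); apply: eq_bigr => l _.
  by case: (u l) => x y /=; rewrite mulr0 subr0.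
by case: (u l) => x y /=; rewrite mulr0 add0r mulrC.
Qed.

Lemma sum_normc_dsin (R : realType) (M : nat) (u : 'I_M.+1 -> R[i]) :
  \sum_(j < M.+1 | (0 < j < M)%N)
     normc (\sum_(l < M.+1 | (0 < l < M)%N) u l * (dsin R M l j)%:C) ^+ 2 =
  M%:R / 2 * \sum_(l < M.+1 | (0 < l < M)%N) normc (u l) ^+ 2.
Proof.
apply: (sum_normc_orthogonal (P := fun j : 'I_M.+1 => (0 < j < M)%N)
  (S := fun l j => dsin R M l j)) => l m hl hm.
rewrite -(sum_interior_ord M (fun j => dsin R M l j * dsin R M m j)).
exact: dsin_orthogonal.
Qed.

(** * The substeps *)

Lemma sin_mu_grid (R : realType) (a b : R) (M l j : nat) : a < b ->
  sin (mu a b l * (grid_pt a b M j - a)) = dsin R M l j.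
Proof.
move=> lt_ab; rewrite /mu /grid_pt /dsin; congr (sin _).
have [->|M_gt0] := posnP M; first by rewrite !invr0; ring.
by field; rewrite pnatr_eq0 -lt0n M_gt0 subr_eq0 gt_eqF.
Qed.

Lemma normc_cexp (R : realType) (z : R[i]) :
  normc (cexp z) = expR (complex.Re z).
Proof.
rewrite normcM /= expr0n addr0 sqrtr_sqr ger0_norm ?expR_ge0 //.
by rewrite cos2Dsin2 sqrtr1 mulr1.
Qed.

Lemma normc_real (R : rcfType) (x : R) : normc x%:C = `|x|.
Proof. by rewrite /= expr0n addr0 sqrtr_sqr. Qed.

Lemma l2norm_sqr (R : realType) (a b : R) (M : nat) (U : 'I_M.+1 -> R[i]) :
  a < b -> l2norm a b U ^+ 2 =
  (b - a) / M%:R * \sum_(j < M.+1 | (0 < j < M)%N) normc (U j) ^+ 2.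
Proof.
move=> lt_ab; rewrite sqr_sqrtr // mulr_ge0 //.
  by rewrite divr_ge0 // subr_ge0 ltW.
by apply: sumr_ge0 => j _; apply: sqr_ge0.
Qed.

(** The Parseval identity, used for the inverse and then for the direct
    transform, contributes [M / 2] each time; the square of the normalization
    [2 / M] of the sine coefficients cancels both factors. *)
Lemma l2norm_kinetic (R : realType) (a b k : R) (M : nat)
    (U : 'I_M.+1 -> R[i]) : a < b -> (0 < M)%N ->
  l2norm a b (kinetic_substep a b k U) = l2norm a b U.
Proof.
move=> lt_ab M_gt0; rewrite /l2norm; congr (Num.sqrt (_ * _)).
under eq_bigr => j _ do rewrite /kinetic_substep sum_interior_ord.
under eq_bigr => j _ do under eq_bigr => l _ do rewrite sin_mu_grid //.
rewrite sum_normc_dsin.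
under eq_bigr => l _.
  rewrite normcM normc_cexp expR0 mul1r /sine_coef normcM normc_real exprMn.
  under eq_bigr => j _ do rewrite sin_mu_grid // dsinC.
  over.
rewrite -mulr_sumr sum_normc_dsin real_normK ?num_real //.
by field; rewrite pnatr_eq0 -lt0n.
Qed.

Lemma normc_local_substep (R : realType) (a b sigma beta : R) (V g : R -> R)
    (h : R -> R -> R) (k : R) (M : nat) (U : 'I_M.+1 -> R[i]) j :
  normc (local_substep a b sigma beta V g h k U j) =
  expR (- damping_F g h (normc (U j) ^+ 2) (k / 2)) * normc (U j).
Proof. by rewrite normcM normc_cexp. Qed.

Lemma damping_F_ge0 (R : realType) (g : R -> R) (h : R -> R -> R) (s r : R) :
  (forall x, 0 <= x -> 0 <= g x) -> is_damping_flow g h -> 0 <= s ->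
  0 <= damping_F g h s r.
Proof.
move=> g_ge0 h_flow s_ge0; have [_ h_ge0 _ _] := h_flow s s_ge0.
apply: Rintegral_ge0 => tau /=; rewrite in_itv /= => /andP[tau_ge0 _].
exact/g_ge0/h_ge0.
Qed.

(** Under linear damping the exponent does not depend on the amplitude [s]:
    this is what makes the decay of the norm exact. *)
Lemma damping_F_linear (R : realType) (g : R -> R) (h : R -> R -> R)
    (delta s r : R) :
  (forall x, 0 <= x -> g x = delta) -> is_damping_flow g h -> 0 <= s ->
  0 <= r -> damping_F g h s r = delta * r.
Proof.
move=> g_delta h_flow s_ge0 r_ge0; have [_ h_ge0 _ _] := h_flow s s_ge0.
rewrite /damping_F (@eq_Rintegral _ _ _ _ _ (cst delta)); last first.
  move=> tau; rewrite inE /= in_itv /= => /andP[tau_ge0 _].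
  exact/g_delta/h_ge0.
rewrite Rintegral_cst //= lebesgue_measure_itv /= lte_fin.
case: ltP => [_|r_le0]; first by rewrite -EFinB /= subr0.
by rewrite (le_anti (_ : r <= 0 <= r)) ?r_le0 // mulr0.
Qed.

Lemma l2norm_local_le (R : realType) (a b sigma beta : R) (V g : R -> R)
    (h : R -> R -> R) (k : R) (M : nat) (U : 'I_M.+1 -> R[i]) :
  a < b -> (forall x, 0 <= x -> 0 <= g x) -> is_damping_flow g h ->
  l2norm a b (local_substep a b sigma beta V g h k U) <= l2norm a b U.
Proof.
move=> lt_ab g_ge0 h_flow; rewrite ler_wsqrtr // ler_wpM2l //.
  by rewrite divr_ge0 // subr_ge0 ltW.
apply: ler_sum => j _; rewrite normc_local_substep exprMn.
rewrite ler_piMl ?sqr_ge0 // expr_le1 ?expR_ge0 // expR_le1 oppr_le0.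
exact/damping_F_ge0/sqr_ge0.
Qed.

Lemma l2norm_local_linear (R : realType) (a b sigma beta : R) (V g : R -> R)
    (h : R -> R -> R) (k delta : R) (M : nat) (U : 'I_M.+1 -> R[i]) :
  a < b -> (forall x, 0 <= x -> g x = delta) -> is_damping_flow g h -> 0 <= k ->
  l2norm a b (local_substep a b sigma beta V g h k U) ^+ 2 =
  expR (- delta * k) * l2norm a b U ^+ 2.
Proof.
move=> lt_ab g_delta h_flow k_ge0; rewrite !l2norm_sqr // mulrCA; congr (_ * _).
rewrite mulr_sumr; apply: eq_bigr => j _.
rewrite normc_local_substep exprMn -expRM_natl.
rewrite (damping_F_linear g_delta) ?sqr_ge0 ?divr_ge0 //.
by congr (expR _ * _); field.
Qed.

(** A step forces the boundary values to [0], but the norm sees the interior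
    nodes only. *)
Lemma l2norm_tssp_step (R : realType) (a b sigma beta : R) (V g : R -> R)
    (h : R -> R -> R) (k : R) (M : nat) (U : 'I_M.+1 -> R[i]) :
  l2norm a b (tssp_step a b sigma beta V g h k U) =
  l2norm a b (local_substep a b sigma beta V g h k
    (kinetic_substep a b k (local_substep a b sigma beta V g h k U))).
Proof.
rewrite /l2norm; congr (Num.sqrt (_ * _)); apply: eq_bigr => j j_int.
by rewrite /tssp_step j_int.
Qed.

(** * Stability *)

Lemma l2norm_tssp_step_le (R : realType) (a b sigma beta : R) (V g : R -> R)
    (h : R -> R -> R) (k : R) (M : nat) (U : 'I_M.+1 -> R[i]) :
  a < b -> (0 < M)%N -> (forall x, 0 <= x -> 0 <= g x) -> is_damping_flow g h ->
  l2norm a b (tssp_step a b sigma beta V g h k U) <= l2norm a b U.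
Proof.
move=> lt_ab M_gt0 g_ge0 h_flow; rewrite l2norm_tssp_step.
apply: le_trans (l2norm_local_le _ _ _ _ _ lt_ab g_ge0 h_flow) _.
by rewrite l2norm_kinetic // l2norm_local_le.
Qed.

Lemma l2norm_tssp_step_linear (R : realType) (a b sigma beta : R)
    (V g : R -> R) (h : R -> R -> R) (k delta : R) (M : nat)
    (U : 'I_M.+1 -> R[i]) :
  a < b -> (0 < M)%N -> (forall x, 0 <= x -> g x = delta) ->
  is_damping_flow g h -> 0 <= k ->
  l2norm a b (tssp_step a b sigma beta V g h k U) ^+ 2 =
  expR (- 2 * delta * k) * l2norm a b U ^+ 2.
Proof.
move=> lt_ab M_gt0 g_delta h_flow k_ge0.
rewrite l2norm_tssp_step (l2norm_local_linear _ _ _ _ lt_ab g_delta) //.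
rewrite l2norm_kinetic // (l2norm_local_linear _ _ _ _ lt_ab g_delta) //.
by rewrite mulrA -expRD; congr (expR _ * _); ring.
Qed.

Theorem lemma2p1 (R : realType) (a b sigma beta : R) (V : R -> R)
    (g : R -> R) (h : R -> R -> R) (psi0 : R -> R[i])
    (hab : a < b) (hsigma : 0 < sigma) (hbeta : 0 < beta)
    (g_incr : forall s t : R, 0 <= s -> s <= t -> g s <= g t)
    (g_ge0 : forall s : R, 0 <= s -> 0 <= g s)
    (h_flow : is_damping_flow g h)
    (psi0a : psi0 a = 0) (psi0b : psi0 b = 0) :
  (forall (M : nat) (k : R), (0 < M)%N -> ~~ odd M -> 0 < k ->
     let psi := tssp a b sigma beta V g h psi0 k (M := M) in
     forall n : nat,
       [/\ l2norm a b (psi n.+1) <= l2norm a b (psi n),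
           l2norm a b (psi n) <= l2norm a b (psi 0%N) &
           l2norm a b (psi 0%N) = l2norm a b (sample a b (M := M) psi0)])
  /\
  (forall delta : R, 0 < delta -> (forall s : R, 0 <= s -> g s = delta) ->
     forall (M : nat) (k : R), (0 < M)%N -> ~~ odd M -> 0 < k ->
     let psi := tssp a b sigma beta V g h psi0 k (M := M) in
     forall n : nat, (0 < n)%N ->
       l2norm a b (psi n) ^+ 2
         = expR (- 2 * delta * (n%:R * k)) * l2norm a b (psi 0%N) ^+ 2 /\
       expR (- 2 * delta * (n%:R * k)) * l2norm a b (psi 0%N) ^+ 2
         = expR (- 2 * delta * (n%:R * k))
           * l2norm a b (sample a b (M := M) psi0) ^+ 2).
Proof.
split=> [M k M_gt0 _ k_gt0 psi n|
         delta delta_gt0 g_delta M k M_gt0 _ k_gt0 psi n _].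
  have psi_le m : l2norm a b (psi m.+1) <= l2norm a b (psi m).
    exact: l2norm_tssp_step_le.
  split=> //; elim: n => // n; exact: le_trans.
have psi_step m : l2norm a b (psi m.+1) ^+ 2 =
    expR (- 2 * delta * k) * l2norm a b (psi m) ^+ 2.
  by apply: l2norm_tssp_step_linear; rewrite ?ltW.
split=> //; elim: n => [|n IHn]; first by rewrite mul0r mulr0 expR0 mul1r.
rewrite psi_step IHn mulrA -expRD -natr1.
by congr (expR _ * _); ring.
Qed.
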